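(* Let $\Sigma$ be a countable set of $\mathcal{L}^{2}_{\Theta}$-sentences. Then for any $\mathcal{L}^{2}_{\Theta}$-sentence $\varphi$, $\Sigma\models\varphi$ implies $\Sigma\vdash\varphi$.
   Context: Fix a countable first-order vocabulary of predicate constants $P_0,P_1,\dots$ (with identity). Let $\Theta$ be a countable set of first-order formulas, each written $\theta(\overline{x},\overline{y})$ where $\overline{x}$ is a nonempty tuple of distinguished free variables (its length $l+1$ is the arity of $\theta$) and $\overline{y}$ lists the remaining free variables (parameters). Enumerate $\Theta$ as $\theta^{l+1}_n$ ($n,l\in\omega$), $l+1$ being the arity. The language $\mathcal{L}^{2}_{\Theta}$ is the second-order language over this vocabulary with first-order variables $x_0,x_1,\dots$ and, for each arity $l+1$, countably many second-order variables $V^{l+1}_m$; atomic formulas are the first-order ones together with $V^{l+1}_m(t_1,\dots,t_{l+1})$ and $V_m=V_n$ (same arity); formulas are built with $\neg,\wedge,\forall$ over both sorts (other connectives and $\exists$ defined as usual). Semantics: for a structure $\mathfrak{A}$ with domain $A$, $K^A_\Theta$ is the collection of all $B\subseteq A^k$ (all $k$) such that there is $\theta(\overline{x},\overline{y})\in\Theta$ with $\overline{x}$ of length $k$ and a sequence $\overline{e}$ of elements of $A$ with $B=\{\overline{d}:\mathfrak{A}\models\theta[\overline{d},\overline{e}]\}$. The pair $(\mathfrak{A},K^A_\Theta)$ is a standard structure; in it, second-order variables of arity $k$ range over the $k$-ary members of $K^A_\Theta$, and $V_m=V_n$ is interpreted as equality of relations. $\Sigma\models\varphi$ means every standard structure satisfying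 all sentences of $\Sigma$ satisfies $\varphi$. For a formula $\psi$, a second-order variable $V^{l+1}_m$ and $n\in\omega$, $\psi^{l+1,m}_n$ is obtained by replacing any expression $V^{l+1}_m(\overline{x})$ (not bound by a quantifier) in $\psi$ by $\theta^{l+1}_n(\overline{x},\overline{y})$ and prefixing the resulting formula with the string of quantifiers $\forall\overline{x}$. Proof system: any complete set of axioms for first-order logic, plus the schemata (A1) $\forall\overline{y}\,\exists V\,\forall\overline{x}\,(V(\overline{x})\leftrightarrow\theta(\overline{x},\overline{y}))$ for each $\theta(\overline{x},\overline{y})\in\Theta$; (A2) $\forall V_m,V_n(\forall\overline{x}(V_m(\overline{x})\leftrightarrow V_n(\overline{x}))\leftrightarrow V_m=V_n)$ (same arity); (A3) $\forall V_m,V_n(V_m=V_n\rightarrow(\psi\rightarrow\psi'))$ where $\psi'$ results from $\psi$ by replacing some occurrences of $V_m$ by $V_n$ (same arity); (A4) $\forall V_m\psi\rightarrow\psi(V_m/V_n)$ where $V_n$ is free for $V_m$ in $\psi$ (same arity); (A5) $\forall V_m(\psi\rightarrow\chi)\rightarrow(\psi\rightarrow\forall V_m\chi)$ where $V_m$ is not free in $\psi$; (A6) $\forall V^{l+1}_m\psi\rightarrow\psi^{l+1,m}_n$ for all $m,n$; and rules (R1) modus ponens; (R2) from $\psi$ infer $\forall V\psi$ and $\forall x\psi$; (R3) from $\chi\rightarrow\psi^{l+1,m}_0,\ \chi\rightarrow\psi^{l+1,m}_1,\dots$ infer $\chi\rightarrow\forall V^{l+1}_m\psi$. A deduction of $\psi$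 from $\Sigma$ is a countable sequence of formulas ending with $\psi$, each member of which is in $\Sigma$, an axiom, or obtained from previous members by one of (R1)–(R3); write $\Sigma\vdash\psi$. *)

(* Defs.v *)
From mathcomp Require Import all_boot.
From mathcomp Require Import boolp classical_sets cardinality.

Set Implicit Arguments.
Unset Strict Implicit.
Unset Printing Implicit Defensive.

Local Open Scope classical_set_scope.
Local Open Scope nat_scope.

(* Formulas are taken modulo renaming of bound variables: bound variables of   *)
(* both sorts are de Bruijn indices, and a free occurrence of the index i,     *)
(* once the binders above it are discounted, is the variable x_i, resp.        *)
(* V^{l+1}_i.  Quantification over a named variable is [allx] and [allV]       *)
(* below.  All substitutions are therefore capture-avoiding.  Second-order     *)
(* variables of different arities are numbered independently; the number [l]   *)
(* stands for the arity l+1.                                                   *)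

Record vocabulary := Vocabulary {
  symbol :> countType;
  arity : symbol -> nat }.

Inductive fo (S : vocabulary) : Type :=
| FPred (p : S) of (arity p).-tuple nat
| FEq of nat & nat
| FNeg of fo S
| FAnd of fo S & fo S
| FAll of fo S.

Inductive form (S : vocabulary) : Type :=
| Pred (p : S) of (arity p).-tuple nat
| Eq of nat & nat
| SV (l m : nat) of l.+1.-tuple nat
| SEq (l m n : nat)
| Neg of form S
| And of form S & form S
| All of form S
| AllV (l : nat) of form S.

Arguments FEq {S}.
Arguments Eq {S}.
Arguments SV {S}.
Arguments SEq {S}.

Section Syntax.
Variable S : vocabulary.
Implicit Types (phi psi chi : form S).

Definition Imp phi psi := Neg (And phi (Neg psi)).
Definition Iff phi psi := And (Imp phi psi) (Imp psi phi).
Definition ExV (l : nat) phi := Neg (AllV l (Neg phi)).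

Fixpoint emb (a : fo S) : form S :=
  match a with
  | FPred p ts => Pred ts
  | FEq i j => Eq i j
  | FNeg b => Neg (emb b)
  | FAnd b c => And (emb b) (emb c)
  | FAll b => All (emb b)
  end.

(* Least k such that every free first-order variable x_i satisfies i < k. *)
Fixpoint fvb phi : nat :=
  match phi with
  | Pred p ts => \max_(i <- ts) i.+1
  | Eq i j => maxn i.+1 j.+1
  | SV l m ts => \max_(i <- ts) i.+1
  | SEq _ _ _ => 0
  | Neg a => fvb a
  | And a b => maxn (fvb a) (fvb b)
  | All a => (fvb a).-1
  | AllV _ a => fvb a
  end.

(* The second-order variable V^{l+1}_m occurs free. *)
Fixpoint sfree (l m : nat) phi : bool :=
  match phi with
  | Pred _ _ | Eq _ _ => false
  | SV l' m' _ => (l' == l) && (m' == m)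
  | SEq l' m' n' => (l' == l) && ((m' == m) || (n' == m))
  | Neg a => sfree l m a
  | And a b => sfree l m a || sfree l m b
  | All a => sfree l m a
  | AllV l' a => sfree l (if l' == l then m.+1 else m) a
  end.

Definition sentence phi : Prop := fvb phi = 0 /\ forall l m, ~~ sfree l m phi.

Definition up (r : nat -> nat) (i : nat) : nat :=
  if i is j.+1 then (r j).+1 else 0.

Fixpoint ren (r : nat -> nat) phi : form S :=
  match phi with
  | Pred p ts => Pred (map_tuple r ts)
  | Eq i j => Eq (r i) (r j)
  | SV l m ts => SV l m (map_tuple r ts)
  | SEq l m n => SEq l m n
  | Neg a => Neg (ren r a)
  | And a b => And (ren r a) (ren r b)
  | All a => All (ren (up r) a)
  | AllV l a => AllV l (ren r a)
  end.

Fixpoint sren (l : nat) (r : nat -> nat) phi : form S :=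
  match phi with
  | Pred p ts => Pred ts
  | Eq i j => Eq i j
  | SV l' m ts => SV l' (if l' == l then r m else m) ts
  | SEq l' m n =>
      if l' == l then SEq l' (r m) (r n) else SEq l' m n
  | Neg a => Neg (sren l r a)
  | And a b => And (sren l r a) (sren l r b)
  | All a => All (sren l r a)
  | AllV l' a => AllV l' (sren l (if l' == l then up r else r) a)
  end.

(* [forall x_k, phi]: the free x_k becomes the bound index 0. *)
Definition allx (k : nat) phi : form S :=
  All (ren (fun i => if i == k then 0 else i.+1) phi).

(* [forall V^{l+1}_m, phi] *)
Definition allV (l m : nat) phi : form S :=
  AllV l (sren l (fun i => if i == m then 0 else i.+1) phi).

Definition xbar (l : nat) : l.+1.-tuple nat := [tuple val i | i < l.+1].

(* A formula theta(xbar, ybar) of arity l+1 has x_0, ..., x_l as its           *)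
(* distinguished variables xbar and x_{l+1}, x_{l+2}, ... as its parameters;   *)
(* ybar is x_{l+1}, ..., x_{l + nparams l theta}.                              *)
Definition nparams (l : nat) (theta : fo S) : nat := fvb (emb theta) - l.+1.

(* Replaces V^{l+1}_m by theta in a formula lying under d first-order binders, *)
(* the parameter x_{l+1+j} of theta being the variable x_j outside these       *)
(* binders.  An equation V_m = V_k, where V_m has no argument to be replaced,  *)
(* is read as [forall xbar, V_m(xbar) <-> V_k(xbar)].                          *)
Fixpoint substV (l m d : nat) (theta : fo S) phi : form S :=
  match phi with
  | Pred p ts => Pred ts
  | Eq i j => Eq i j
  | SV l' m' ts =>
      if (l' == l) && (m' == m) then
        ren (fun i => if i < l.+1 then nth 0 ts i else i - l.+1 + d) (emb theta)
      else SV l' m' ts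
  | SEq l' a b =>
      if (l' == l) && ((a == m) || (b == m)) then
        let atom c :=
          if c == m then ren (fun i => if i < l.+1 then i else i + d) (emb theta)
          else SV l c (xbar l) in
        iter l.+1 (@All S) (Iff (atom a) (atom b))
      else SEq l' a b
  | Neg a => Neg (substV l m d theta a)
  | And a b => And (substV l m d theta a) (substV l m d theta b)
  | All a => All (substV l m d.+1 theta a)
  | AllV l' a => AllV l' (substV l (if l' == l then m.+1 else m) d theta a)
  end.

(* [forall ybar, psi(theta(_, ybar) / V^{l+1}_m)], with ybar kept apart from   *)
(* the free variables of psi by shifting the latter.                           *)
Definition substV_closed (l m : nat) (theta : fo S) psi : form S :=
  let p := nparams l theta in
  iter p (@All S) (substV l m 0 theta (ren (addn p) psi)).

(* The second formula results from the first by replacing some of the free     *)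
(* occurrences of V^{l+1}_m by V^{l+1}_n.                                      *)
Inductive replV (l : nat) : nat -> nat -> form S -> form S -> Prop :=
| replV_refl m n a : replV l m n a a
| replV_SV m n ts : replV l m n (SV l m ts) (SV l n ts)
| replV_SEql m n b : replV l m n (SEq l m b) (SEq l n b)
| replV_SEqr m n a : replV l m n (SEq l a m) (SEq l a n)
| replV_SEq m n : replV l m n (SEq l m m) (SEq l n n)
| replV_Neg m n a a' : replV l m n a a' -> replV l m n (Neg a) (Neg a')
| replV_And m n a a' b b' :
    replV l m n a a' -> replV l m n b b' -> replV l m n (And a b) (And a' b')
| replV_All m n a a' : replV l m n a a' -> replV l m n (All a) (All a')
| replV_AllV m n l' a a' :
    replV l (if l' == l then m.+1 else m) (if l' == l then n.+1 else n) a a' ->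
    replV l m n (AllV l' a) (AllV l' a').

End Syntax.

Record structure (S : vocabulary) := Structure {
  dom : Type;
  dom_inhabited : inhabited dom;
  interp : forall p : S, set ((arity p).-tuple dom) }.

Definition scons (T : Type) (a : T) (s : nat -> T) (i : nat) : T :=
  if i is j.+1 then s j else a.

Section Semantics.
Variables (S : vocabulary) (M : structure S).

Fixpoint fosat (s : nat -> dom M) (a : fo S) : Prop :=
  match a with
  | FPred p ts => interp (map_tuple s ts)
  | FEq i j => s i = s j
  | FNeg b => ~ fosat s b
  | FAnd b c => fosat s b /\ fosat s c
  | FAll b => forall d, fosat (scons d s) b
  end.

(* K^A_Theta, its (l+1)-ary members being given as sets of sequences of length *)
(* l+1.  Here [foldr scons e ds] assigns ds to xbar and e to ybar.             *)
Definition KTheta (Theta : nat -> nat -> fo S) (l : nat) : set (set (seq (dom M))) :=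
  [set B | exists (n : nat) (e : nat -> dom M),
     B = [set ds | size ds = l.+1 /\ fosat (foldr (@scons _) e ds) (Theta l n)]].

Definition assignV := nat -> nat -> set (seq (dom M)).

Definition vcons (l : nat) (B : set (seq (dom M))) (E : assignV) : assignV :=
  fun l' m => if l' == l then (if m is m'.+1 then E l' m' else B) else E l' m.

Fixpoint sat (Theta : nat -> nat -> fo S) (s : nat -> dom M) (E : assignV)
    (phi : form S) : Prop :=
  match phi with
  | Pred p ts => interp (map_tuple s ts)
  | Eq i j => s i = s j
  | SV l m ts => E l m (map s ts)
  | SEq l m n => E l m = E l n
  | Neg a => ~ sat Theta s E a
  | And a b => sat Theta s E a /\ sat Theta s E b
  | All a => forall d, sat Theta (scons d s) E a
  | AllV l a => forall B, KTheta Theta l B -> sat Theta s (vcons l B E) a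
  end.

Definition models (Theta : nat -> nat -> fo S) (phi : form S) : Prop :=
  forall (s : nat -> dom M) (E : assignV),
    (forall l m, KTheta Theta l (E l m)) -> sat Theta s E phi.

End Semantics.

Definition entails (S : vocabulary) (Theta : nat -> nat -> fo S)
    (Sigma : set (form S)) (phi : form S) : Prop :=
  forall M : structure S,
    (forall sigma, Sigma sigma -> models M Theta sigma) -> models M Theta phi.

Definition fo_valid (Q : vocabulary) (a : fo Q) : Prop :=
  forall (M : structure Q) (s : nat -> dom M), fosat s a.

(* Replaces each atom q(t_0, ..., t_{k-1}) by (tau q)(t_0, ..., t_{k-1}), where *)
(* tau q has its free first-order variables among x_0, ..., x_{k-1}.            *)
Fixpoint inst (Q S : vocabulary) (tau : Q -> form S) (a : fo Q) : form S :=
  match a with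
  | FPred q ts => ren (nth 0 ts) (tau q)
  | FEq i j => Eq i j
  | FNeg b => Neg (inst tau b)
  | FAnd b c => And (inst tau b) (inst tau c)
  | FAll b => All (inst tau b)
  end.

Inductive fo_derivable (S : vocabulary) (Ax : set (form S)) : form S -> Prop :=
| fo_ax a : Ax a -> fo_derivable Ax a
| fo_mp a b : fo_derivable Ax a -> fo_derivable Ax (Imp a b) -> fo_derivable Ax b
| fo_gen k a : fo_derivable Ax a -> fo_derivable Ax (allx k a).

(* Ax yields every second-order formula that is a substitution instance of a   *)
(* valid first-order formula.                                                  *)
Definition fo_complete (S : vocabulary) (Ax : set (form S)) : Prop :=
  forall (Q : vocabulary) (a : fo Q) (tau : Q -> form S),
    fo_valid a -> (forall q, fvb (tau q) <= arity q) ->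
    fo_derivable Ax (inst tau a).

Section Deduction.
Variables (S : vocabulary) (Theta : nat -> nat -> fo S).
Variables (FOAx Sigma : set (form S)).

Inductive axiom : form S -> Prop :=
| ax_fo a : FOAx a -> axiom a
| ax_comprehension l n :
    axiom (iter (nparams l (Theta l n)) (@All S)
            (ExV l (iter l.+1 (@All S)
              (Iff (SV l 0 (xbar l)) (emb (Theta l n))))))
| ax_extensionality l m n :
    axiom (allV l m (allV l n
      (Iff (iter l.+1 (@All S) (Iff (SV l m (xbar l)) (SV l n (xbar l))))
           (SEq l m n))))
| ax_replacement l m n psi psi' : replV l m n psi psi' ->
    axiom (allV l m (allV l n (Imp (SEq l m n) (Imp psi psi'))))
| ax_instantiation l m n psi :
    axiom (Imp (allV l m psi) (sren l (fun i => if i == m then n else i) psi))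
| ax_distribution l m psi chi : ~~ sfree l m psi ->
    axiom (Imp (allV l m (Imp psi chi)) (Imp psi (allV l m chi)))
| ax_definable_instantiation l m n psi :
    axiom (Imp (allV l m psi) (substV_closed l m (Theta l n) psi)).

Inductive justified (previous : set (form S)) : form S -> Prop :=
| by_hypothesis psi : Sigma psi -> justified previous psi
| by_axiom psi : axiom psi -> justified previous psi
| by_modus_ponens psi chi :
    previous psi -> previous (Imp psi chi) -> justified previous chi
| by_generalizationV l m psi : previous psi -> justified previous (allV l m psi)
| by_generalization k psi : previous psi -> justified previous (allx k psi)
| by_omega l m chi psi :
    (forall n, previous (Imp chi (substV_closed l m (Theta l n) psi))) ->
    justified previous (Imp chi (allV l m psi)).

Definition well_order (T : Type) (lt : T -> T -> Prop) : Prop :=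
  [/\ well_founded lt, forall i j k, lt i j -> lt j k -> lt i k &
      forall i j, [\/ lt i j, i = j | lt j i]].

(* A deduction is a sequence indexed by a countable well-ordered set (it may   *)
(* be transfinite, because of the infinitary rule) with a last member.         *)
Definition proves (phi : form S) : Prop :=
  exists (I : countType) (lt : I -> I -> Prop) (d : I -> form S) (last : I),
    [/\ well_order lt,
        forall i, i = last \/ lt i last,
        d last = phi &
        forall i, justified [set psi | exists2 j, lt j i & d j = psi] (d i)].

End Deduction.

(* Main.v *)
Require Import Defs.
From HB Require Import structures.
From mathcomp Require Import all_boot.
From mathcomp Require Import boolp classical_sets cardinality.
From Stdlib Require Import Relation_Operators Wellfounded Eqdep_dec.

(* If [phi] is not provable, [~ phi] is extended to a Henkin theory by a chain  *)
(* of consistent formulas, consistency of [chi] meaning that [~ chi] is not     *)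
(* provable.  A refuted [forall x, b] is witnessed by a fresh first-order       *)
(* variable.  A refuted [forall V, b] is witnessed by some theta_n, for by (R3) *)
(* the formula would otherwise be provable from the current one; its            *)
(* parameters are witnessed later as first-order variables.  Thus no free       *)
(* second-order variable ever occurs, and (A6), (R1)-(R3) and first-order logic *)
(* suffice.  The first-order variables modulo provable equality form the model. *)

Set Implicit Arguments.
Unset Strict Implicit.
Unset Printing Implicit Defensive.

Local Open Scope classical_set_scope.
Local Open Scope nat_scope.

(** The argument is Henkin's, combined with the witnessing idea of omega-logic. As (R3) has
    infinitely many premises, a union of consistent theories may be inconsistent, so each stage of
    the construction is a single formula [x], tested by what [Imp x b] is provable from [Sigma]. By
    contraposition of (R3), if [x] does not yield [forall V, b], then for some n it does not yield
    the instance at theta_n, and the negation of that instance can be added to [x] ([decide_step]).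
    Countably many stages decide all formulas without free second-order variables and give a set [T]
    with witnesses of both sorts ([henkin_extension]).

    In the term model of [T], second-order quantifiers range over the sets defined by the theta_n.
    By [sat_substV_closed], substituting theta_n and quantifying its parameters universally
    expresses truth at every set that theta_n defines. Hence membership in [T] is truth ([truth]),
    and the model satisfies [Sigma] but not the unprovable formula. Transfinite deductions are
    combined in [proves_countable]. *)

(** * Countability of the set of formulas *)

Section Encoding.
Variable S : vocabulary.

(** The code makes [form S] a [countType], which serves twice: [henkin_extension] enumerates
    formulas by it, and [formvoc] takes formulas as its symbols. *)
Fixpoint form_code (a : form S) : GenTree.tree (S + seq nat) :=
  match a with
  | Pred p ts => GenTree.Node 0 [:: GenTree.Leaf (inl p); GenTree.Leaf (inr (tval ts))]
  | Eq i j => GenTree.Node 1 [:: GenTree.Leaf (inr [:: i; j])]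
  | SV l m ts => GenTree.Node 2 [:: GenTree.Leaf (inr [:: l, m & tval ts])]
  | SEq l m n => GenTree.Node 3 [:: GenTree.Leaf (inr [:: l; m; n])]
  | Neg b => GenTree.Node 4 [:: form_code b]
  | And b c => GenTree.Node 5 [:: form_code b; form_code c]
  | All b => GenTree.Node 6 [:: form_code b]
  | AllV l b => GenTree.Node 7 [:: GenTree.Leaf (inr [:: l]); form_code b]
  end.

Fixpoint form_decode (t : GenTree.tree (S + seq nat)) : option (form S) :=
  match t with
  | GenTree.Node 0 [:: GenTree.Leaf (inl p); GenTree.Leaf (inr ts)] =>
      omap (@Pred S p) (insub ts)
  | GenTree.Node 1 [:: GenTree.Leaf (inr [:: i; j])] => Some (Eq i j)
  | GenTree.Node 2 [:: GenTree.Leaf (inr [:: l, m & ts])] =>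
      omap (SV l m) (insub ts)
  | GenTree.Node 3 [:: GenTree.Leaf (inr [:: l; m; n])] => Some (SEq l m n)
  | GenTree.Node 4 [:: t1] => omap (@Neg S) (form_decode t1)
  | GenTree.Node 5 [:: t1; t2] =>
      if form_decode t1 is Some b then omap (And b) (form_decode t2) else None
  | GenTree.Node 6 [:: t1] => omap (@All S) (form_decode t1)
  | GenTree.Node 7 [:: GenTree.Leaf (inr [:: l]); t1] =>
      omap (AllV l) (form_decode t1)
  | _ => None
  end.

Lemma form_codeK : pcancel form_code form_decode.
Proof.
elim=> [p ts|i j|l m ts|l m n|b IH|b IHb c IHc|b IH|l b IH] //=.
- by rewrite valK.
- by rewrite valK.
- by rewrite IH.
- by rewrite IHb IHc.
- by rewrite IH.
- by rewrite IH.
Qed.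

HB.instance Definition _ := Countable.copy (form S) (pcan_type form_codeK).

End Encoding.

(** * Renamings and free variables *)

Section Renaming.
Variable S : vocabulary.
Implicit Types (a b : form S) (r : nat -> nat).

Lemma fvb_args (ts : seq nat) i : i \in ts -> i < \max_(j <- ts) j.+1.
Proof. by move=> its; exact: (@leq_bigmax_seq _ ts xpredT (fun j : nat => j.+1) i). Qed.

Lemma eq_ren r r' a :
  (forall i, i < fvb a -> r i = r' i) -> ren r a = ren r' a.
Proof.
elim: a r r' => [p ts|i j|l m ts|l m n|b IH|b IHb c IHc|b IH|l b IH] r r' /= h.
- congr Pred; apply: val_inj => /=; apply/eq_in_map => i /fvb_args; exact: h.
- by rewrite !h // leq_max leqnn // orbT.
- congr SV; apply: val_inj => /=; apply/eq_in_map => i /fvb_args; exact: h.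
- by [].
- by rewrite (IH r r').
- rewrite (IHb r r') 1?(IHc r r') // => i hi; apply: h; by rewrite leq_max hi ?orbT.
- rewrite (IH _ (up r')) //; case=> //= i hi; rewrite h //; by case: (fvb b) hi.
- by rewrite (IH r r').
Qed.

Lemma up_id : up id = id.
Proof. by apply/funext; case. Qed.

Lemma ren_id a : ren id a = a.
Proof.
elim: a => [p ts|i j|l m ts|l m n|b IH|b IHb c IHc|b IH|l b IH] //=;
  rewrite ?up_id ?IH ?IHb ?IHc //.
- congr Pred; apply: val_inj => /=; exact: map_id.
- congr SV; apply: val_inj => /=; exact: map_id.
Qed.

Lemma ren_id_on r a : (forall i, i < fvb a -> r i = i) -> ren r a = a.
Proof. by move=> h; rewrite (@eq_ren r id) // ren_id. Qed.

Lemma ren_comp r r' a : ren r (ren r' a) = ren (r \o r') a.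
Proof.
elim: a r r' => [p ts|i j|l m ts|l m n|b IH|b IHb c IHc|b IH|l b IH] r r' //=;
  rewrite ?IH ?IHb ?IHc //.
- congr Pred; apply: val_inj => /=; by rewrite -map_comp.
- congr SV; apply: val_inj => /=; by rewrite -map_comp.
- by congr (All (ren _ b)); apply/funext; case.
Qed.

Lemma sren_id_on l r a :
  (forall m, sfree l m a -> r m = m) -> sren l r a = a.
Proof.
elim: a r => [p ts|i j|l' m ts|l' m n|b IH|b IHb c IHc|b IH|l' b IH] r //= h.
- by case: eqP h => //= _ h; rewrite h.
- case: eqP h => //= _ h; by rewrite !h ?eqxx ?orbT.
- by rewrite IH.
- rewrite IHb ?IHc // => m hm; apply: h; by rewrite hm ?orbT.
- by rewrite IH.
- rewrite IH //; case: eqP h => _ h m hm //.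
  + by case: m hm => //= m hm; rewrite h // eqxx.
  + by apply: h; rewrite hm.
Qed.

Lemma sfree_ren l m r a : sfree l m (ren r a) = sfree l m a.
Proof.
by elim: a l m r => [p ts|i j|l' m' ts|l' m' n|b IH|b IHb c IHc|b IH|l' b IH] l m r //=;
  rewrite ?IHb ?IHc.
Qed.

Lemma sfree_emb l m (t : fo S) : sfree l m (emb t) = false.
Proof. by elim: t => //= b -> c ->. Qed.

Lemma sfree_iter_All l m p a : sfree l m (iter p (@All S) a) = sfree l m a.
Proof. by elim: p. Qed.

(** A first-order formula brings no second-order variable with it, and V_m disappears, also from
    equations. So instantiating an outermost second-order quantifier leaves no new second-order
    variable free. *)
Lemma sfree_substV l k m d (t : fo S) l' a :
  sfree l' k (substV l m d t a) -> sfree l' k a && ~~ ((l' == l) && (k == m)).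
Proof.
elim: a k m d => [p ts|i j|l0 m' ts|l0 m' n|b IH|b IHb c IHc|b IH|l0 b IH] k m d //=.
- case: ifP => [_|]; first by rewrite sfree_ren sfree_emb.
  move=> /= h /andP[/eqP e1 /eqP e2]; subst; rewrite !eqxx /=.
  by move: h => /negbT.
- case: ifP => [/andP[/eqP -> _]|h /=].
  + move=> /=; rewrite sfree_iter_All /=.
    case: (m' =P m) => [->|/eqP nm]; case: (n =P m) => [->|/eqP nn];
    rewrite /= ?sfree_ren ?sfree_emb ?orbF /=.
    * by [].
    * rewrite ?orbb => /andP[/eqP -> /eqP <-]; by rewrite !eqxx ?orbT /= nn.
    * rewrite ?orbb => /andP[/eqP -> /eqP <-]; by rewrite !eqxx ?orbT /= nm.
    * rewrite -?andb_orr => /andP[/eqP -> h]; rewrite !eqxx /=.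
      have /orP[/eqP <-|/eqP <-] : (m' == k) || (n == k) by move: h; do !case: eqP.
      - by rewrite eqxx nm.
      - by rewrite eqxx orbT nn.
  + move=> /andP[/eqP e1 h2]; subst; rewrite eqxx h2 /=.
    apply/negP => /andP[/eqP e /eqP e']; subst.
    by move: h; rewrite eqxx h2.
- exact: IH.
- by case/orP => [/IHb|/IHc] /andP[-> ->]; rewrite ?orbT.
- exact: IH.
- move/IH => /andP[-> /=]; case: (l' =P l) => //= ->.
  by case: (l0 == l); rewrite ?eqSS.
Qed.

Lemma sfree_substV_closed l k m (t : fo S) l' a :
  sfree l' k (substV_closed l m t a) -> sfree l' k a && ~~ ((l' == l) && (k == m)).
Proof.
by rewrite /substV_closed sfree_iter_All => /sfree_substV; rewrite sfree_ren.
Qed.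

End Renaming.

(** * Semantics of renaming and substitution *)

Section Satisfaction.
Variables (S : vocabulary) (M : structure S) (Theta : nat -> nat -> fo S).
Implicit Types (a b : form S) (s : nat -> dom M) (E : assignV M).

Lemma sat_emb s E (t : fo S) : sat Theta s E (emb t) <-> fosat s t.
Proof.
elim: t s => [p ts|i j|b IH|b IHb c IHc|b IH] s //=.
- by rewrite IH.
- by rewrite IHb IHc.
- by split=> h d; apply/IH.
Qed.

Lemma eq_sat s s' E E' a :
  (forall i, i < fvb a -> s i = s' i) ->
  (forall l m, sfree l m a -> E l m = E' l m) ->
  sat Theta s E a <-> sat Theta s' E' a.
Proof.
elim: a s s' E E' => [p ts|i j|l m ts|l m n|b IH|b IHb c IHc|b IH|l b IH] s s' E E' /= hs hE.
- have -> : map_tuple s ts = map_tuple s' ts; last by [].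
  apply: val_inj => /=; apply/eq_in_map => i /fvb_args; exact: hs.
- by rewrite !hs // leq_max leqnn // orbT.
- rewrite hE ?eqxx //; suff -> : map s ts = map s' ts by [].
  by apply/eq_in_map => i /fvb_args; exact: hs.
- by rewrite !hE ?eqxx ?orbT.
- by rewrite (IH s s' E E').
- rewrite (IHb s s' E E') 1?(IHc s s' E E') // => [i|l m|i|l m] h.
  + by apply: hs; rewrite leq_max h orbT.
  + by apply: hE; rewrite h orbT.
  + by apply: hs; rewrite leq_max h.
  + by apply: hE; rewrite h.
- suff e d : sat Theta (scons d s) E b <-> sat Theta (scons d s') E' b.
    by split=> h d; apply/e.
  by apply: IH => //; case=> //= i hi; apply: hs; case: (fvb b) hi.
- suff e B : sat Theta s (vcons l B E) b <-> sat Theta s' (vcons l B E') b.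
    by split=> h B hB; apply/e/h.
  apply: IH => // l' m hm; rewrite /vcons; case: (l' =P l) hm => [->|/eqP n] hm.
    by case: m hm => //= m hm; apply: hE; rewrite eqxx.
  by apply: hE; rewrite eq_sym (negbTE n).
Qed.

Lemma sat_ren r s E a : sat Theta s E (ren r a) <-> sat Theta (s \o r) E a.
Proof.
elim: a r s E => [p ts|i j|l m ts|l m n|b IH|b IHb c IHc|b IH|l b IH] r s E //=.
- have -> : map_tuple s (map_tuple r ts) = map_tuple (s \o r) ts; last by [].
  by apply: val_inj; rewrite /= -map_comp.
- by rewrite -map_comp.
- by rewrite IH.
- by rewrite IHb IHc.
- have e d : scons d s \o up r = scons d (s \o r) by apply/funext; case.
  by split=> h d; move: (h d); rewrite IH e.
- by split=> h B hB; apply/IH/h.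
Qed.

Lemma sat_iter_All p s E a :
  sat Theta s E (iter p (@All S) a) <->
  forall ds, size ds = p -> sat Theta (foldr (@scons _) s ds) E a.
Proof.
elim: p s => [|p IH] s /=.
  by split=> [h [] //|h]; exact: (h [::]).
split=> [h ds|h d].
  (* The outermost quantifier supplies the last entry of the list, hence the decomposition from the
     right. *)
  case/lastP: ds => // ds d; rewrite size_rcons => -[sz].
  by rewrite foldr_rcons; apply: (proj1 (IH _)).
apply/IH => ds sz; rewrite -foldr_rcons; apply: h; by rewrite size_rcons sz.
Qed.

Lemma foldr_scons s (ds : seq (dom M)) i (x0 : dom M) :
  foldr (@scons _) s ds i = if i < size ds then nth x0 ds i else s (i - size ds).
Proof.
by elim: ds i => [|d ds IH] [|i] //=; rewrite ?subn0 // IH ltnS subSS.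
Qed.

Definition assign_upd E l m (B : set (seq (dom M))) : assignV M :=
  fun l' m' => if (l' == l) && (m' == m) then B else E l' m'.

Definition defset l (t : fo S) (e : nat -> dom M) : set (seq (dom M)) :=
  [set ds | size ds = l.+1 /\ fosat (foldr (@scons _) e ds) t].

Lemma map_foldr_xbar l s (ds : seq (dom M)) : size ds = l.+1 ->
  [seq foldr (@scons _) s ds i | i <- xbar l] = ds.
Proof.
move=> sz; have [x0] := dom_inhabited M.
apply: (@eq_from_nth _ x0); first by rewrite size_map size_tuple sz.
move=> i; rewrite size_map size_tuple => hi.
have e : nth 0 (xbar l) i = i.
  exact: (nth_mktuple _ 0 (Ordinal hi)).
rewrite (nth_map 0) ?size_tuple // e (foldr_scons _ _ _ x0) sz hi //.
Qed.

(** The parameters are read off [s] beyond the [d] binders passed. The length condition makes sets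
    equal once they agree on sequences of length l+1, which is how [substV] expands an equation. *)
Lemma sat_substV l m d (t : fo S) s E a :
  (forall c ds, E l c ds -> size ds = l.+1) ->
  sat Theta s E (substV l m d t a) <->
  sat Theta s (assign_upd E l m (defset l t (fun j => s (j + d)))) a.
Proof.
have [x0] := dom_inhabited M.
elim: a m d s E => [p ts|i j|l' m' ts|l' m' n|b IH|b IHb c IHc|b IH|l' b IH] m d s E szE //=.
- rewrite /assign_upd; case: ifP => [/andP[/eqP e _]|_] //=; subst.
  rewrite sat_ren sat_emb /defset /= size_map size_tuple.
  set s1 := (_ \o _); set s2 := foldr _ _ _.
  have -> : s1 = s2.
    apply/funext => i; rewrite /s1 /s2 /= (foldr_scons _ _ _ x0) size_map size_tuple.
    by case: ifP => // hi; rewrite (nth_map 0) ?size_tuple.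
  by split=> [|[]].
- case: ifP => [/andP[/eqP e h]|h]; last first.
    rewrite /assign_upd /=; case: eqP h => //= ->.
    by move=> /negbT; rewrite negb_or => /andP[/negbTE -> /negbTE ->].
  subst; rewrite -[X in X <-> _]/(sat Theta s E (iter l.+1 (@All S) _)) sat_iter_All.
  pose atom c := if c == m then ren (fun i => if i < l.+1 then i else i + d) (emb t)
    else SV l c (xbar l).
  set E' := assign_upd _ _ _ _.
  have at_sat c ds : size ds = l.+1 ->
      sat Theta (foldr (@scons _) s ds) E (atom c) <-> E' l c ds.
    move=> sz; rewrite /atom /E' /assign_upd eqxx /=; case: ifP => _.
      rewrite sat_ren sat_emb /defset /= sz.
      set s1 := (_ \o _); set s2 := foldr _ _ _.
      have -> : s1 = s2.
        apply/funext => i; rewrite /s1 /s2 /= !(foldr_scons _ _ _ x0) sz.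
        case: (ltnP i l.+1) => [->//|hi].
        by rewrite ltnNge (leq_trans hi (leq_addr _ _)) /= addnBAC.
      by split=> [|[]].
    by rewrite /= map_foldr_xbar.
  have szE' c ds : E' l c ds -> size ds = l.+1.
    rewrite /E' /assign_upd eqxx /=; case: ifP => _; [by case|exact: szE].
  rewrite -/(atom m') -/(atom n).
  have key ds : size ds = l.+1 ->
    (sat Theta (foldr (@scons _) s ds) E (Iff (atom m') (atom n)) <->
     (E' l m' ds <-> E' l n ds)).
    move=> sz; rewrite /= (at_sat m' ds sz) (at_sat n ds sz).
    split=> [[h1 h2]|[h1 h2]]; last tauto.
    by split=> x; apply: contrapT => y; [apply: h1|apply: h2].
  split=> [hE|e ds sz]; last by apply/(key ds sz); rewrite e.
  apply/seteqP; split=> ds hds; have sz := szE' _ _ hds;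
    by apply (proj1 (key ds sz) (hE ds sz)).
- by rewrite IH.
- by rewrite IHb // IHc.
- have e x : (fun j => scons x s (j + d.+1)) = (fun j => s (j + d)).
    by apply/funext => j; rewrite addnS.
  by split=> h x; move: (h x); rewrite IH // e.
- suff e B : KTheta Theta l' B ->
      sat Theta s (vcons l' B E) (substV l (if l' == l then m.+1 else m) d t b) <->
      sat Theta s (vcons l' B (assign_upd E l m (defset l t (fun j => s (j + d))))) b.
    by split=> h B hB; apply/(e B hB)/h.
  move=> [n0 [e0 hB]]; rewrite IH.
    set E1 := assign_upd _ _ _ _; set E2 := vcons _ _ _.
    suff -> : E1 = E2 by [].
    apply/funext => l1; apply/funext => m1.
    rewrite /E1 /E2 /assign_upd /vcons.
    case: (l1 =P l) => [->|nl] /=; last by [].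
    rewrite (eq_sym l' l); case: (l =P l') => [_|//].
    by case: m1 => //= m1.
  (* A bound set lies in [KTheta], so the length condition survives the quantifier. *)
  move=> c ds; rewrite /vcons; case: eqP => [el|_]; last exact: szE.
  case: c => [|c]; last exact: szE.
  by rewrite hB el => -[].
Qed.

Lemma eq_fosat s s' (t : fo S) : (forall i, i < fvb (emb t) -> s i = s' i) ->
  fosat s t <-> fosat s' t.
Proof.
move=> h; rewrite -!(sat_emb _ (fun _ _ => set0)); exact: eq_sat.
Qed.

Lemma sat_substV_closed l m (t : fo S) s E a :
  (forall c ds, E l c ds -> size ds = l.+1) ->
  sat Theta s E (substV_closed l m t a) <->
  forall e, sat Theta s (assign_upd E l m (defset l t e)) a.
Proof.
move=> szE; rewrite /substV_closed sat_iter_All; set p := nparams l t.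
have [x0] := dom_inhabited M.
have shift ds : size ds = p -> foldr (@scons _) s ds \o addn p = s.
  move=> sz; apply/funext => i /=.
  by rewrite (foldr_scons _ _ _ x0) sz ltnNge leq_addr /= addKn.
split=> [h e|h ds sz]; last first.
  by rewrite sat_substV // sat_ren shift //.
(* The quantifier block covers the [p] parameters that can occur in [t]; by [agree], later values of
   [e] do not affect the defined set. *)
have := h (mkseq e p) (size_mkseq _ _).
rewrite sat_substV // sat_ren shift ?size_mkseq //.
set e' := fun j => _; suff -> : defset l t e' = defset l t e by [].
have agree ds : size ds = l.+1 ->
    fosat (foldr (@scons _) e' ds) t <-> fosat (foldr (@scons _) e ds) t.
  move=> sz; apply: eq_fosat => i hi; rewrite !(foldr_scons _ _ _ x0) sz.
  case: (ltnP i l.+1) => // li; rewrite /e' addn0 (foldr_scons _ _ _ x0) size_mkseq.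
  have lt_ip : i - l.+1 < p by rewrite ltn_sub2r // (leq_ltn_trans li).
  by rewrite lt_ip nth_mkseq.
by apply/seteqP; split=> ds [sz hd]; split=> //; apply/(agree ds sz).
Qed.

End Satisfaction.

(** * Transfinite deductions and derivable first-order schemes *)

Section Deductions.
Variables (S : vocabulary) (Theta : nat -> nat -> fo S).
Variables (FOAx Sigma : set (form S)).
Hypothesis FOAx_complete : fo_complete FOAx.
Notation prov := (proves Theta FOAx Sigma).
Notation just := (justified Theta FOAx Sigma).

Lemma justified_mono (P P' : set (form S)) psi :
  P `<=` P' -> just P psi -> just P' psi.
Proof.
move=> sub; case.
- exact: by_hypothesis.
- exact: by_axiom.
- by move=> a b pa pab; apply: (@by_modus_ponens _ _ _ _ _ a); apply: sub.
- by move=> l m a pa; apply: by_generalizationV; apply: sub.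
- by move=> k a pa; apply: by_generalization; apply: sub.
- by move=> l m chi a h; apply: by_omega => n; apply: sub.
Qed.

Lemma lexprod_trans (I : nat -> Type) (lt : forall n, I n -> I n -> Prop) :
  (forall n i j k, lt n i j -> lt n j k -> lt n i k) ->
  forall u v w, lexprod _ _ (fun m n => m < n) lt u v ->
    lexprod _ _ (fun m n => m < n) lt v w ->
    lexprod _ _ (fun m n => m < n) lt u w.
Proof.
move=> tr u v w; case=> [m n i j mn|n i j ij].
  by move=> h; inversion h; subst; apply: left_lex => //; exact: ltn_trans mn _.
move=> h; inversion h; subst; first by apply: left_lex.
apply: right_lex; apply: tr ij _.
by rewrite -(inj_pair2_eq_dec _ PeanoNat.Nat.eq_dec _ _ _ _ H1).
Qed.

(* The deductions of countably many premisses are laid end to end, as an       *)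
(* ordered sum of type omega, and the conclusion is put on top.                *)
Lemma proves_countable (f : nat -> form S) psi :
  (forall n, prov (f n)) -> just (range f) psi -> prov psi.
Proof.
move=> f_prov hpsi.
(* Choice fixes one deduction for each premise; its components are extracted and then made
   opaque. *)
have I_ n := cid (f_prov n); have lt_ n := cid (projT2 (I_ n)).
have d_ n := cid (projT2 (lt_ n)); have last_ n := cid (projT2 (d_ n)).
pose I n : countType := projT1 (I_ n).
pose lt n : I n -> I n -> Prop := projT1 (lt_ n).
pose d n : I n -> form S := projT1 (d_ n).
pose last n : I n := projT1 (last_ n).
have h n : [/\ well_order (lt n), forall i, i = last n \/ lt n i (last n),
    d n (last n) = f n & forall i, just [set a | exists2 j, lt n j i & d n j = a] (d n i)].
  exact: projT2 (last_ n).
clearbody last d lt I; clear I_ lt_ d_ last_ f_prov.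
pose J : countType := option {n : nat & I n}.
pose lex := lexprod nat (fun n => I n) (fun m n => m < n) lt.
pose ltJ (x y : J) : Prop :=
  match x, y with
  | Some u, Some v => lex u v
  | Some _, None => True
  | None, _ => False
  end.
pose dJ (x : J) := if x is Some u then d (projT1 u) (projT2 u) else psi.
have lex_wf : well_founded lex.
  apply: wf_lexprod => [|n]; first by elim/ltn_ind => n IH; constructor.
  by case: (h n) => -[].
exists J, ltJ, dJ, None; split; [split| |by []|].
- have accS u : Acc ltJ (Some u).
    elim/(well_founded_ind lex_wf): u => u IH; constructor => -[v|//] /= vu; exact: IH.
  case=> [u|]; first exact: accS.
  by constructor => -[v|//] _; exact: accS.
- move=> [u|] [v|] [w|] //=; apply: lexprod_trans => n.
  by case: (h n) => -[].
- move=> [[m i]|] [[n j]|] /=; [|by constructor 1|by constructor 3|by constructor 2].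
    case: (ltngtP m n) => [mn|nm|e].
    * by constructor 1; apply: left_lex.
    * by constructor 3; apply: left_lex.
    * subst n; case: (h m) => -[_ _ /(_ i j)[ij|->|ji] _ _ _].
      - by constructor 1; apply: right_lex.
      - by constructor 2.
      - by constructor 3; apply: right_lex.
- by case=> [u|]; [right|left].
- case=> [[n i]|] /=.
  + have [_ _ _ /(_ i)] := h n; apply: justified_mono => _ [j ji <-].
    by exists (Some (existT _ n j)) => //; apply: right_lex.
  + apply: justified_mono hpsi => _ [n _ <-].
    have [_ _ <- _] := h n.
    by exists (Some (existT _ n (last n))).
Qed.

Lemma proves_justified0 psi : just set0 psi -> prov psi.
Proof.
move=> h; exists unit, (fun _ _ => False), (fun=> psi), tt; split; [split| |by []|].
- by move=> i; constructor.
- by [].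
- by case=> -[]; constructor 2.
- by case; left.
- by move=> i; apply: justified_mono h => x [].
Qed.

Lemma proves_mp a b : prov (Imp a b) -> prov a -> prov b.
Proof.
move=> pab pa; apply: (@proves_countable (fun n => if n is 0 then a else Imp a b)).
  by case.
by apply: (@by_modus_ponens _ _ _ _ _ a); [exists 0|exists 1].
Qed.

Lemma proves_gen k a : prov a -> prov (allx k a).
Proof.
move=> pa; apply: (@proves_countable (fun=> a)) => //.
by apply: by_generalization; exists 0.
Qed.

Lemma proves_omega l m chi psi :
  (forall n, prov (Imp chi (substV_closed l m (Theta l n) psi))) ->
  prov (Imp chi (allV l m psi)).
Proof.
move=> h; apply: (proves_countable h); apply: by_omega => n; by exists n.
Qed.

Lemma proves_axiom a : Defs.axiom Theta FOAx a -> prov a.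
Proof. by move=> h; apply: proves_justified0; apply: by_axiom. Qed.

Lemma proves_hyp a : Sigma a -> prov a.
Proof. by move=> h; apply: proves_justified0; apply: by_hypothesis. Qed.

Lemma proves_fo a : fo_derivable FOAx a -> prov a.
Proof.
elim=> [{}a h|{}a b _ pa _ pab|k {}a _]; last exact: proves_gen.
  by apply: proves_axiom; apply: ax_fo.
exact: proves_mp pab pa.
Qed.

(* Every second-order formula serves as a predicate symbol, applied to its     *)
(* free variables, so that any first-order scheme is the instance under [id]   *)
(* of a first-order formula over this vocabulary.                              *)
Definition formvoc : vocabulary := @Vocabulary (form S) (@fvb S).

Definition atom (r : nat -> nat) (a : form S) : fo formvoc :=
  @FPred formvoc a [tuple r i | i < fvb a].

Notation finst := (@inst formvoc S (fun a : form S => a)).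

Definition FImp (a b : fo formvoc) := FNeg (FAnd a (FNeg b)).

Lemma inst_atom r a : finst (atom r a) = ren r a.
Proof.
rewrite /=; apply: eq_ren => i hi.
exact: (nth_mktuple _ 0 (Ordinal hi)).
Qed.

Lemma inst_Neg a : finst (FNeg a) = Neg (finst a).
Proof. by []. Qed.

Lemma inst_And a b : finst (FAnd a b) = And (finst a) (finst b).
Proof. by []. Qed.

Lemma inst_All a : finst (FAll a) = All (finst a).
Proof. by []. Qed.

Lemma inst_Imp a b : finst (FImp a b) = Imp (finst a) (finst b).
Proof. by []. Qed.

Definition instE := (inst_Imp, inst_Neg, inst_And, inst_All, inst_atom, ren_id).

Lemma fosat_atom (M : structure formvoc) (s s' : nat -> dom M) r r' a :
  (forall i, i < fvb a -> s (r i) = s' (r' i)) ->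
  fosat s (atom r a) <-> fosat s' (atom r' a).
Proof.
move=> h /=; suff -> : map_tuple s [tuple r i | i < fvb a] =
  map_tuple s' [tuple r' i | i < fvb a] by [].
by apply: val_inj; rewrite /= -!map_comp; apply: eq_map => i /=; apply: h.
Qed.

Lemma fosat_FImp (M : structure formvoc) (s : nat -> dom M) a b :
  fosat s (FImp a b) <-> (fosat s a -> fosat s b).
Proof. by split=> [h ha|h /= [] //]; [apply: contrapT => nb; apply: h | tauto]. Qed.

Lemma proves_valid (a : fo formvoc) : fo_valid a -> prov (finst a).
Proof. by move=> va; apply: proves_fo; apply: FOAx_complete. Qed.

Notation at_ := (atom id).

Lemma proves_refl a : prov (Imp a a).
Proof.
have := @proves_valid (FImp (at_ a) (at_ a)).
by rewrite !instE; apply => M s /=; tauto.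
Qed.

Lemma proves_K a x : prov a -> prov (Imp x a).
Proof.
apply: proves_mp; have := @proves_valid (FImp (at_ a) (FImp (at_ x) (at_ a))).
by rewrite !instE; apply => M s /=; tauto.
Qed.

Lemma proves_S x a b : prov (Imp x (Imp a b)) -> prov (Imp x a) -> prov (Imp x b).
Proof.
move=> h1; apply: proves_mp; apply: proves_mp h1.
have := @proves_valid (FImp (FImp (at_ x) (FImp (at_ a) (at_ b)))
  (FImp (FImp (at_ x) (at_ a)) (FImp (at_ x) (at_ b)))).
by rewrite !instE; apply => M s /=; tauto.
Qed.

Lemma proves_trans x a b : prov (Imp x a) -> prov (Imp a b) -> prov (Imp x b).
Proof. by move=> xa /(proves_K x) xab; apply: proves_S xab xa. Qed.

Lemma proves_Andl a b : prov (Imp (And a b) a).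
Proof.
have := @proves_valid (FImp (FAnd (at_ a) (at_ b)) (at_ a)).
by rewrite !instE; apply => M s /=; tauto.
Qed.

Lemma proves_Andr a b : prov (Imp (And a b) b).
Proof.
have := @proves_valid (FImp (FAnd (at_ a) (at_ b)) (at_ b)).
by rewrite !instE; apply => M s /=; tauto.
Qed.

Lemma proves_And_intro a b : prov (Imp a (Imp b (And a b))).
Proof.
have := @proves_valid (FImp (at_ a) (FImp (at_ b) (FAnd (at_ a) (at_ b)))).
by rewrite !instE; apply => M s /=; tauto.
Qed.

Lemma proves_contra x a : prov (Imp x a) -> prov (Imp x (Neg a)) -> prov (Neg x).
Proof.
move=> h; apply: proves_mp; apply: proves_mp h.
have := @proves_valid (FImp (FImp (at_ x) (at_ a))
  (FImp (FImp (at_ x) (FNeg (at_ a))) (FNeg (at_ x)))).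
by rewrite !instE; apply => M s /=; tauto.
Qed.

Lemma proves_cases x a : prov (Neg (And x a)) -> prov (Imp x a) -> prov (Neg x).
Proof.
move=> h; apply: proves_mp; apply: proves_mp h.
have := @proves_valid (FImp (FNeg (FAnd (at_ x) (at_ a)))
  (FImp (FImp (at_ x) (at_ a)) (FNeg (at_ x)))).
by rewrite !instE; apply => M s /=; tauto.
Qed.

Lemma proves_NN a : prov (Neg (Neg a)) -> prov a.
Proof.
apply: proves_mp; have := @proves_valid (FImp (FNeg (FNeg (at_ a))) (at_ a)).
by rewrite !instE; apply => M s /=; tauto.
Qed.

Lemma proves_inst y b : prov (Imp (All b) (ren (scons y id) b)).
Proof.
have := @proves_valid (FImp (FAll (at_ b)) (atom (scons y id) b)).
rewrite !instE; apply => M s; apply/fosat_FImp => /(_ (s y)).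
by apply: (proj1 (fosat_atom _)); case.
Qed.

(** [y] is an eigenvariable: index 0 of [b] is the bound variable, so the bound [y.+1] keeps x_y out
    of [All b]. Abstracting x_y again restores [b] and merely shifts [x]. *)
Lemma proves_All_intro y x b : fvb x <= y -> fvb b <= y.+1 ->
  prov (Imp x (ren (scons y id) b)) -> prov (Imp x (All b)).
Proof.
move=> xy bly /(proves_gen y); rewrite /allx /=.
set r := fun _ => _.
have -> : ren r x = ren succn x.
  by apply: eq_ren => i ix; rewrite /r ltn_eqF // (leq_trans ix).
rewrite ren_comp [ren _ b]ren_id_on; last first.
  case=> [|i] ib; rewrite /r /= ?eqxx // ltn_eqF //.
  by rewrite -ltnS (leq_trans ib).
apply: proves_mp.
have := @proves_valid (FImp (FAll (FImp (atom succn x) (at_ b)))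
  (FImp (at_ x) (FAll (at_ b)))).
rewrite !instE; apply => M s; apply/fosat_FImp => h; apply/fosat_FImp => hx d.
apply: (proj1 (@fosat_FImp _ (scons d s) (atom succn x) (at_ b)) (h d)); exact: (proj2 (@fosat_atom M (scons d s) s succn id x (fun _ _ => erefl)) hx).
Qed.

Lemma proves_Eq_refl i : prov (Eq i i).
Proof. by apply: (@proves_valid (FEq i i)) => M s. Qed.

Lemma proves_Eq_sym i j : prov (Imp (Eq i j) (Eq j i)).
Proof.
by apply: (@proves_valid (FImp (FEq i j) (FEq j i))) => M s; apply/fosat_FImp => /= ->.
Qed.

Lemma proves_Eq_trans i j k : prov (Imp (Eq i j) (Imp (Eq j k) (Eq i k))).
Proof.
apply: (@proves_valid (FImp (FEq i j) (FImp (FEq j k) (FEq i k)))) => M s.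
by apply/fosat_FImp => h; apply/fosat_FImp; exact: etrans h.
Qed.

(** A single valid formula replaces all free variables at once, the required equations being nested
    in front as hypotheses. *)
Lemma proves_Eq_congr r a :
  prov (foldr (fun i b => Imp (Eq i (r i)) b) (Imp a (ren r a)) (iota 0 (fvb a))).
Proof.
have := @proves_valid
  (foldr (fun i b => FImp (FEq i (r i)) b) (FImp (at_ a) (atom r a)) (iota 0 (fvb a))).
have -> : finst (foldr (fun i b => FImp (FEq i (r i)) b) (FImp (at_ a) (atom r a))
    (iota 0 (fvb a))) =
    foldr (fun i b => Imp (Eq i (r i)) b) (Imp a (ren r a)) (iota 0 (fvb a)).
  by elim: (iota _ _) => [|i s IH]; [rewrite /foldr !instE | rewrite /= -IH].
apply => M s.
suff h ts : ((forall i, i \in ts -> s i = s (r i)) -> fosat s (FImp (at_ a) (atom r a))) ->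
    fosat s (foldr (fun i b => FImp (FEq i (r i)) b) (FImp (at_ a) (atom r a)) ts).
  apply: h => h; apply/fosat_FImp; apply: (proj1 (fosat_atom _)) => i ia.
  by apply: h; rewrite mem_iota.
elim: ts => [|i ts IH] h; first exact: h.
apply/fosat_FImp => /= e; apply: IH => h'; apply: h => j; rewrite inE.
by case/orP => [/eqP ->|/h'].
Qed.

(** * Construction of the Henkin theory *)

Implicit Types a b x : form S.

(** First-order variables may stay free: they play the part of Henkin constants. *)
Definition sclosed a := forall l m, ~~ sfree l m a.

Lemma sclosed_AllV_free l l' b k :
  sclosed (AllV l b) -> sfree l' k b -> (l' == l) && (k == 0).
Proof.
(* For [l' = l] and positive [k], index [k] under the binder is [k.-1] outside it, hence the second
   instance. *)
move=> cl fr; have := cl l' k; have := cl l' k.-1; rewrite /= (eq_sym l).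
by case: eqP fr => _; case: k => [|k] //= ->.
Qed.

(** This passes from the de Bruijn quantifier to the named one, in terms of which (R3) and (A6) are
    stated. *)
Lemma allV_sclosed l b : sclosed (AllV l b) -> allV l 0 b = AllV l b.
Proof.
move=> cl; congr AllV; apply: sren_id_on => m /(sclosed_AllV_free cl)/andP[_].
by move=> /eqP ->.
Qed.

Lemma sclosed_substV_closed l n b :
  sclosed (AllV l b) -> sclosed (substV_closed l 0 (Theta l n) b).
Proof.
move=> cl l' m; apply/negP => /sfree_substV_closed /andP[fr].
by rewrite (sclosed_AllV_free cl fr).
Qed.

Definition consistent x := ~ prov (Neg x).

Definition refuted x a : Prop := prov (Imp x (Neg a)) /\
  match a with
  | All b => exists y, prov (Imp x (Neg (ren (scons y id) b)))
  | AllV l b => exists n, prov (Imp x (Neg (substV_closed l 0 (Theta l n) b)))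
  | _ => True
  end.

Lemma decide_step x a : consistent x -> sclosed a ->
  exists x', [/\ consistent x', prov (Imp x' x) & prov (Imp x' a) \/ refuted x' a].
Proof.
move=> cx ca; have [cxa|ncxa] := EM (consistent (And x a)).
  exists (And x a); split=> //; first exact: proves_Andl.
  by left; exact: proves_Andr.
have {ncxa}pxa : prov (Neg (And x a)) by exact: contrapT.
set z := And x (Neg a).
(* [Imp x a] is by definition [Neg (And x (Neg a))], so consistency of [z] is literally
   unprovability of [Imp x a]; [witness] uses this again. *)
have cz : consistent z by move=> pz; apply: cx; exact: (proves_cases pxa (pz : prov (Imp x a))).
have zx : prov (Imp z x) by exact: proves_Andl.
have zna : prov (Imp z (Neg a)) by exact: proves_Andr.
have nza : ~ prov (Imp z a) by move=> za; apply: cz; apply: proves_contra za zna.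
have witness b : ~ prov (Imp z b) -> [/\ consistent (And z (Neg b)),
    prov (Imp (And z (Neg b)) x), prov (Imp (And z (Neg b)) (Neg a)) &
    prov (Imp (And z (Neg b)) (Neg b))].
  move=> nzb; split; [exact: nzb| | |exact: proves_Andr].
  - exact: proves_trans (proves_Andl _ _) zx.
  - exact: proves_trans (proves_Andl _ _) zna.
have default : (refuted z a) -> exists x', [/\ consistent x', prov (Imp x' x) &
  prov (Imp x' a) \/ refuted x' a] by move=> ra; exists z; split=> //; right.
case: (a) (ca) zna nza witness default =>
    [p ts|i j|l m ts|l m n|b|b c|b|l b] ca' zna nza witness default;
  try exact: default.
(* Free variables lie below [fvb], so the maximum is fresh for both [z] and [b]. *)
- have [|c1 c2 c3 c4] := witness (ren (scons (maxn (fvb z) (fvb b)) id) b).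
    move=> pz; apply: nza; apply: proves_All_intro pz => //.
      exact: leq_maxl.
    by apply: leqW; exact: leq_maxr.
  by eexists; split; [exact: c1|exact: c2|right; split=> //; eexists; exact: c4].
(* Contrapositive of (R3): if [z] implied every instance, it would imply the quantified formula. *)
- have [n nzn] : exists n, ~ prov (Imp z (substV_closed l 0 (Theta l n) b)).
    apply: contrapT => h; apply: nza; rewrite -allV_sclosed //.
    apply: proves_omega => n; apply: contrapT => nzn; apply: h; by exists n.
  have [c1 c2 c3 c4] := witness _ nzn.
  by eexists; split; [exact: c1|exact: c2|right; split=> //; eexists; exact: c4].
Qed.

(** Of the rules, closure is demanded under modus ponens only; [henkin_AllV] stands in for (R3). *)
Record henkin (T : set (form S)) : Prop := Henkin {
  henkin_thm : forall a, prov a -> T a;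
  henkin_mp : forall a b, T (Imp a b) -> T a -> T b;
  henkin_con : forall a, T a -> ~ T (Neg a);
  henkin_dec : forall a, sclosed a -> T a \/ T (Neg a);
  henkin_All : forall b, sclosed (All b) -> T (Neg (All b)) ->
    exists y, T (Neg (ren (scons y id) b));
  henkin_AllV : forall l b, sclosed (AllV l b) -> T (Neg (AllV l b)) ->
    exists n, T (Neg (substV_closed l 0 (Theta l n) b)) }.

Lemma henkin_extension x : consistent x -> exists2 T, henkin T & T x.
Proof.
move=> cx.
have [step stepP] : {f : form S * form S -> form S & forall p,
    consistent p.1 -> sclosed p.2 -> [/\ consistent (f p), prov (Imp (f p) p.1) &
      prov (Imp (f p) p.2) \/ refuted (f p) p.2]}.
  apply: (@choice _ _ (fun p x' => consistent p.1 -> sclosed p.2 -> [/\ consistent x',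
    prov (Imp x' p.1) & prov (Imp x' p.2) \/ refuted x' p.2])) => -[y a] /=.
  have [[cy ca]|h] := EM (consistent y /\ sclosed a); last by exists y => ? ?; case: h.
  by have [x' h] := decide_step cy ca; exists x'.
(* Stage [k.+1] treats the formula with code [k], and changes nothing if there is none or if it has
   a free second-order variable. *)
pose fix X k := if k is k'.+1 then
  (if unpickle k' is Some a then if `[< sclosed a >] then step (X k', a) else X k'
   else X k') else x.
have X_S k : consistent (X k) -> consistent (X k.+1) /\ prov (Imp (X k.+1) (X k)).
  move=> ck /=; have stay : consistent (X k) /\ prov (Imp (X k) (X k)) by split=> //; exact: proves_refl.
  case: unpickle => [a|] //; case: asboolP => // ca.
  by have [] := stepP (X k, a) ck ca.
have X_con k : consistent (X k) by elim: k => // k /X_S[].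
have X_le k n : k <= n -> prov (Imp (X n) (X k)).
  move=> /subnK <-; elim: (n - k) => [|j IH]; first exact: proves_refl.
  by rewrite addSn; have [_ h] := X_S _ (X_con (j + k)); exact: proves_trans h IH.
pose T : set (form S) := fun a => exists k, prov (Imp (X k) a).
have T_le k n a : k <= n -> prov (Imp (X k) a) -> prov (Imp (X n) a).
  by move=> /X_le h1 h2; apply: proves_trans h1 h2.
(* Two contradictory members would both follow from one finite stage. *)
have T_con a : T a -> ~ T (Neg a).
  move=> [k ka] [n na]; apply: (X_con (maxn k n)); apply: (@proves_contra _ a).
    by apply: T_le ka; exact: leq_maxl.
  by apply: T_le na; exact: leq_maxr.
have decided a : sclosed a -> exists k, prov (Imp (X k) a) \/ refuted (X k) a.
  move=> ca; exists (pickle a).+1; rewrite /= pickleK asboolT //.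
  by have [] := stepP (X (pickle a), a) (X_con _) ca.
(* The stage that decides [a] cannot have accepted it, so it supplied a witness. *)
have refute a : sclosed a -> T (Neg a) -> exists k, refuted (X k) a.
  move=> ca na; have [k [ka|]] := decided _ ca; last by exists k.
  by case: (@T_con a) => //; exists k.
exists T; last by exists 0; exact: proves_refl.
split=> //.
- by move=> a pa; exists 0; apply: proves_K.
- move=> a b [k kab] [n na]; exists (maxn k n); apply: (@proves_S _ a).
    by apply: T_le kab; exact: leq_maxl.
  by apply: T_le na; exact: leq_maxr.
- move=> a /decided[k [ka|[kna _]]]; [left|right]; by exists k.
- by move=> b cb /(refute _ cb)[k [_ [y ky]]]; exists y, k.
- by move=> l b cb /(refute _ cb)[k [_ [n kn]]]; exists n, k.
Qed.

Fixpoint nAllV a : nat :=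
  match a with
  | Pred _ _ | Eq _ _ | SV _ _ _ | SEq _ _ _ => 0
  | Neg b => nAllV b
  | And b c => nAllV b + nAllV c
  | All b => nAllV b
  | AllV _ b => (nAllV b).+1
  end.

Lemma nAllV_ren r a : nAllV (ren r a) = nAllV a.
Proof.
by elim: a r => [p ts|i j|l m ts|l m n|b IH|b IHb c IHc|b IH|l b IH] r //=;
  rewrite ?IH ?IHb ?IHc.
Qed.

Lemma nAllV_emb (t : fo S) : nAllV (emb t) = 0.
Proof. by elim: t => //= b -> c ->. Qed.

Lemma nAllV_iter_All p a : nAllV (iter p (@All S) a) = nAllV a.
Proof. by elim: p. Qed.

(** Only first-order quantifiers are introduced, even where an equation is expanded; this is what
    makes the measure in [truth] decrease. *)
Lemma nAllV_substV l m d (t : fo S) a : nAllV (substV l m d t a) = nAllV a.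
Proof.
elim: a m d => [p ts|i j|l' m' ts|l' m' n|b IH|b IHb c IHc|b IH|l' b IH] m d //=;
  rewrite ?IH ?IHb ?IHc //; case: ifP => //= _.
- by rewrite nAllV_ren nAllV_emb.
- rewrite nAllV_iter_All /=.
  by do 2 case: ifP; rewrite ?nAllV_ren ?nAllV_emb.
Qed.

(** * The term model and the truth lemma *)

Section Model.
Variables (T : set (form S)) (hT : henkin T).

Lemma henkin_imp a b : prov (Imp a b) -> T a -> T b.
Proof. by move=> /(henkin_thm hT) /(henkin_mp hT). Qed.

Lemma henkin_Neg a : sclosed a -> T (Neg a) <-> ~ T a.
Proof.
move=> ca; split; first by move=> na /(henkin_con hT).
by case: (henkin_dec hT ca).
Qed.

Lemma henkin_And a b : T (And a b) <-> T a /\ T b.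
Proof.
split=> [h|[ha hb]].
  by split; apply: henkin_imp h; [exact: proves_Andl|exact: proves_Andr].
exact: (henkin_mp hT (henkin_imp (proves_And_intro a b) ha)) hb.
Qed.

(** A representative of the class of [i] under equality in [T], chosen from the class alone; fixed
    points of [rep] replace a quotient. The class contains [i], so the default of [xget] is never
    called upon. *)
Definition rep (i : nat) : nat := xget 0 [set j | T (Eq i j)].

Lemma repP i : T (Eq i (rep i)).
Proof.
rewrite /rep; case: xgetP => [j -> //|/(_ i)[]].
by apply: (henkin_thm hT); exact: proves_Eq_refl.
Qed.

Lemma rep_eq i j : rep i = rep j <-> T (Eq i j).
Proof.
have sym k n : T (Eq k n) -> T (Eq n k) by apply: henkin_imp; exact: proves_Eq_sym.
have tr k n p : T (Eq k n) -> T (Eq n p) -> T (Eq k p).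
  by move=> h; apply: (henkin_mp hT); apply: henkin_imp h; exact: proves_Eq_trans.
split=> [e|ij].
  by apply: tr (repP i) _; rewrite e; apply: sym; exact: repP.
rewrite /rep; congr xget; apply/seteqP; split=> k /= h; last exact: tr ij h.
exact: tr (sym _ _ ij) h.
Qed.

Lemma henkin_congr r a : (forall i, T (Eq i (r i))) -> T a -> T (ren r a).
Proof.
move=> hr; suff: T (Imp a (ren r a)) by exact: henkin_mp.
have /(henkin_thm hT) := proves_Eq_congr r a.
by elim: (iota _ _) => //= i s IH /(henkin_mp hT)/(_ (hr i)).
Qed.

Definition repdom := {i : nat | rep i == i}.

Lemma rep_idem i : rep (rep i) == rep i.
Proof. by apply/eqP/rep_eq; apply: henkin_imp (repP i); exact: proves_Eq_sym. Qed.

Definition cl (i : nat) : repdom := exist _ (rep i) (rep_idem i).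

Definition canonical_structure : structure S :=
  @Structure S repdom (inhabits (cl 0))
    (fun p => [set ts | T (Pred (map_tuple val ts))]).

Lemma cl_val (d : repdom) : cl (val d) = d.
Proof. by apply: val_inj => /=; apply/eqP; exact: (valP d). Qed.

Lemma cl_eq i j : cl i = cl j <-> T (Eq i j).
Proof.
rewrite -rep_eq; split=> [/(congr1 val)//|e]; exact: val_inj.
Qed.

Lemma canonical_Pred p (ts : (arity p).-tuple nat) :
  interp (s := canonical_structure) (map_tuple cl ts) <-> T (Pred ts).
Proof.
have -> : interp (s := canonical_structure) (map_tuple cl ts) = T (ren rep (Pred ts)).
  rewrite /=; congr (T (Pred _)); apply: val_inj; by rewrite /= -map_comp.
split=> [h|]; last by apply: henkin_congr => i; exact: repP.
(* If [T] contained the negation, congruence applied to that negation would contradict [h]. *)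
have [//|/henkin_congr] := @henkin_dec _ hT (Pred ts) (fun _ _ => isT).
by move=> /(_ rep repP) /(henkin_con hT h).
Qed.

Lemma sat_vcons_upd (M : structure S) (s : nat -> dom M) E l B b :
  sclosed (AllV l b) ->
  sat Theta s (vcons l B E) b <-> sat Theta s (assign_upd E l 0 B) b.
Proof.
move=> cb; apply: eq_sat => // l' k /(sclosed_AllV_free cb).
by rewrite /vcons /assign_upd => /andP[/eqP -> /eqP ->]; rewrite eqxx.
Qed.

(* A quantifier over K_Theta is eliminated in favour of the formulas           *)
(* [substV_closed l 0 (Theta l n) b], longer but with one second-order         *)
(* quantifier less, whence the outer induction.                                *)
Lemma truth a r (E : assignV canonical_structure) :
  (forall l c ds, E l c ds -> size ds = l.+1) -> sclosed a ->
  sat Theta (cl \o r : nat -> dom canonical_structure) E a <-> T (ren r a).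
Proof.
move=> szE; have [n] := ubnP (nAllV a).
elim: n a r => // n IHn a.
elim: a => [p ts|i j|l m ts|l m k|b IH|b IHb c IHc|b IH|l b IH] r /= na ca.
- have := canonical_Pred (map_tuple r ts).
  by have -> : map_tuple cl (map_tuple r ts) = map_tuple (cl \o r) ts
    by apply: val_inj; rewrite /= -map_comp.
- exact: cl_eq.
- by have := ca l m; rewrite /= !eqxx.
- by have := ca l m; rewrite /= !eqxx.
- by rewrite IH // henkin_Neg // => l m; rewrite sfree_ren; exact: ca.
- have cb : sclosed b by move=> l m; have := ca l m; rewrite /= negb_or => /andP[].
  have cc : sclosed c by move=> l m; have := ca l m; rewrite /= negb_or => /andP[].
  rewrite henkin_And IHb ?IHc //.
    by apply: leq_ltn_trans na; exact: leq_addl.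
  by apply: leq_ltn_trans na; exact: leq_addr.
- have inst_ren y : ren (scons y id) (ren (up r) b) = ren (scons y r) b.
    by rewrite ren_comp; congr ren; apply/funext; case.
  have IHy y : sat Theta (scons (cl y) (cl \o r) : nat -> dom canonical_structure) E b
      <-> T (ren (scons y r) b).
    rewrite -IH //.
    by have -> : scons (cl y) (cl \o r) = cl \o scons y r by apply/funext; case.
  have cb : sclosed (All (ren (up r) b)).
    by move=> l m; rewrite /= sfree_ren; exact: ca.
  split=> [h|h d].
    apply: contrapT => /(henkin_Neg cb) /(henkin_All hT cb)[y].
    rewrite inst_ren; apply: (henkin_con hT); apply/IHy; exact: h.
  (* Every element of the domain is the class of a variable, so instances at variables suffice. *)
  rewrite -(cl_val d); apply/IHy; rewrite -inst_ren; apply: henkin_imp h.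
  exact: proves_inst.
- have cb : sclosed (AllV l (ren r b)).
    by move=> l' m; rewrite /= sfree_ren; exact: ca.
  (* As [e] varies, these are all the sets defined by [Theta l k]; as [k] varies too, they exhaust
     the range of the quantifier. *)
  have subst_truth k : T (substV_closed l 0 (Theta l k) (ren r b)) <->
      forall e, sat Theta (cl \o r : nat -> dom canonical_structure)
        (vcons l (defset l (Theta l k) e) E) b.
    rewrite -[X in T X]ren_id -IHn; last 2 first.
    + by rewrite /substV_closed nAllV_iter_All nAllV_substV !nAllV_ren.
    + exact: sclosed_substV_closed.
    rewrite sat_substV_closed; last exact: szE.
    by split=> h e; move: (h e); rewrite sat_ren sat_vcons_upd.
  split=> [h|h B [k [e ->]]].
    apply: contrapT => /(henkin_Neg cb) /(henkin_AllV hT cb)[k].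
    apply: (henkin_con hT); apply/subst_truth => e; apply: h; by exists k, e.
  move: e; apply/subst_truth; apply: henkin_imp h.
  rewrite -allV_sclosed //; apply: proves_axiom; exact: ax_definable_instantiation.
Qed.

End Model.

(** * Completeness *)

Lemma completeness a :
  (forall b, Sigma b -> sentence b) -> sclosed a -> entails Theta Sigma a -> prov a.
Proof.
move=> Sigma_sentences ca ent; apply: contrapT => npa.
have cna : consistent (Neg a) by move=> /proves_NN.
have [T hT Tna] := henkin_extension cna.
pose M := canonical_structure hT; pose s : nat -> dom M := cl hT.
have truth_s (b : form S) (E : assignV M) : sclosed b ->
    (forall l m, KTheta Theta l (E l m)) -> sat Theta s E b <-> T b.
  move=> cb hE; rewrite -[X in T X]ren_id; apply: truth => // l c ds.
  by case: (hE l c) => n [e ->] [].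
have mS b : Sigma b -> models M Theta b.
  (* The truth value of a sentence does not depend on [s'], so it can be computed at [s], where
     [truth_s] applies. *)
  move=> Sb s' E hE; have [fvb0 cb] := Sigma_sentences _ Sb.
  apply/(@eq_sat _ _ _ _ s _ E) => //; first by rewrite fvb0.
  by apply/truth_s => //; apply: (henkin_thm hT); exact: proves_hyp.
(* Any assignment into [KTheta] will do; theta_0 with parameters from [s] provides a member of each
   arity. *)
pose E : assignV M := fun l _ => defset l (Theta l 0) s.
have hE l m : KTheta Theta l (E l m) by exists 0, s.
by apply: (henkin_con hT _ Tna); apply/(truth_s _ E) => //; exact: ent.
Qed.

End Deductions.

Theorem mainTheorem5 (S : vocabulary) (Theta : nat -> nat -> fo S)
    (FOAx : set (form S)) (FOAx_complete : fo_complete FOAx)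
    (Sigma : set (form S)) (Sigma_countable : countable Sigma)
    (Sigma_sentences : forall sigma, Sigma sigma -> sentence sigma)
    (phi : form S) (phi_sentence : sentence phi) :
  entails Theta Sigma phi -> proves Theta FOAx Sigma phi.
Proof. by apply: completeness => //; case: phi_sentence. Qed.
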